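(* There is no semi-online colouring algorithm for towers from above, i.e., for any positive integers $k$ and $m$, and for any semi-online algorithm that $k$-colours bottomless rectangles from above, there is a finite family of bottomless rectangles such that any two intersecting rectangles of the family form a tower, and, when the family is presented from above, the algorithm produces (at some step) an $m$-fold covered point that is covered by at most one colour.
   Context: A (closed) bottomless rectangle is a subset of $\mathbb{R}^2$ of the form $\{(x,y): l\le x\le r,\ y\le t\}$, denoted by its parameters $(l,r,t)$; $t$ is its height. Two bottomless rectangles form a ($2$-)tower if they can be labelled $(l_1,r_1,t_1)$, $(l_2,r_2,t_2)$ with $l_1<l_2$, $r_2<r_1$ and $t_1<t_2$. Presenting rectangles from above means in decreasing order of height. A semi-online $k$-colouring algorithm receives the rectangles one by one in the given order, without knowledge of the rectangles still to come. After each new rectangle it may assign one of $k$ colours to any of the so far presented, not yet coloured rectangles (it may leave rectangles uncoloured and colour them later); colours are irrevocable. So after every step there is a partial $k$-colouring of the presented rectangles, determined by the sequence presented so far, and each partial colouring extends the previous one. A point is $m$-fold covered (at a step) if it lies in at least $m$ of the rectangles presented so far. It is covered by a colour if it lies in a presented rectangle that currently has that colour; uncoloured rectangles contribute no colour. *)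

(* Defs.v *)
From HB Require Import structures.
From mathcomp Require Import all_boot all_order all_algebra.
From mathcomp Require Import reals.

Set Implicit Arguments.
Unset Strict Implicit.
Unset Printing Implicit Defensive.

Import Order.TTheory GRing.Theory Num.Theory.

Local Open Scope ring_scope.

(* The parameters are ordered as (l, r, t).  Requiring [l < r] excludes empty
   and degenerate sets, so distinct parameters give distinct subsets of the
   plane and equality of [brect]s is equality of the sets. *)
Record brect (R : realType) := BRect {
  brect_val : R * R * R;
  _ : brect_val.1.1 < brect_val.1.2 }.

HB.instance Definition _ (R : realType) := [isSub for @brect_val R].
HB.instance Definition _ (R : realType) := [Choice of brect R by <:].

Section BottomlessRectangles.
Variable R : realType.
Implicit Types (a b : brect R) (s : seq (brect R)) (p : R * R).

Definition left_end b : R := (brect_val b).1.1.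
Definition right_end b : R := (brect_val b).1.2.
Definition height b : R := (brect_val b).2.

Definition covers b p : bool :=
  (left_end b <= p.1 <= right_end b) && (p.2 <= height b).

Definition intersecting a b : Prop := exists p, covers a p && covers b p.

Definition below_in_tower a b : bool :=
  [&& left_end a < left_end b, right_end b < right_end a & height a < height b].

Definition tower a b : bool := below_in_tower a b || below_in_tower b a.

Definition tower_family s : Prop :=
  {in s &, forall a b, a != b -> intersecting a b -> tower a b}.

(* The decrease is strict: there are no ties, hence no repetitions, and a
   sequence presented from above is determined by the set of its members. *)
Definition from_above s : bool := sorted (fun a b => height b < height a) s.

Definition multiplicity s p : nat := count (covers^~ p) s.

(* [A s b] is the colour of [b] once exactly the rectangles of [s] have been
   presented, in that order; [None] means uncoloured.  The values are
   meaningful only for [b \in s] and [from_above s]. *)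
Definition colouring_rule (k : nat) := seq (brect R) -> brect R -> option 'I_k.

Definition semi_online_from_above k (A : colouring_rule k) : Prop :=
  forall s (new : brect R), from_above (rcons s new) ->
  {in s, forall b (c : 'I_k), A s b = Some c -> A (rcons s new) b = Some c}.

Definition colours_at k (A : colouring_rule k) s p : {set 'I_k} :=
  [set c | has (fun b => covers b p && (A s b == Some c)) s].

End BottomlessRectangles.

(* Main.v *)
Require Import Defs.
From mathcomp Require Import all_boot all_order all_algebra.
From mathcomp Require Import reals.
From mathcomp Require Import boolp.
From mathcomp Require Import lra.

Set Implicit Arguments.
Unset Strict Implicit.
Unset Printing Implicit Defensive.

Import Order.TTheory GRing.Theory Num.Theory.

Local Open Scope ring_scope.

(** In a tower family presented from above, a new rectangle is either disjoint
    from an earlier one or contains its whole base interval.  The adversary is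
    thus growing a forest from the leaves: each new rectangle becomes the
    parent of some of the current roots.  A point over which a vertical line
    meets the family, taken below all heights, is covered by a path going from
    some vertex up to a root.  The aim is such a path of [m] vertices whose
    coloured members all have the same colour.

    Call the colouring state of the [m] topmost vertices of a path its
    pattern.  The target is an instant at which a path ending in a root [l]
    has the same pattern as the path one vertex higher has as soon as [l] has
    received a parent [v].  Since colours are irrevocable, equality of the two
    patterns says that a coloured vertex of the first path has the same colour
    as its child, down the whole path; hence the first path has at most one
    colour.

    A coincidence of patterns is an instance of a statement about an arbitrary
    labelling of paths of [n + 1] vertices by a finite set,
    [exists_path_step_same_label]: some path and its upward shift by one vertex
    get the same label.  This is Linial's speed-up argument for colouring paths
    in the LOCAL model, played as a game.  Given a labelling [f] of paths of
    [n + 2] vertices, label a path of [n + 1] vertices with the set of values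
    of [f] which the adversary can still realize by giving its root a parent.
    If a path and its shift have the same set, then the value that [f] took in
    passing from the path to its shift is also available from the shift, so
    the adversary can produce it once more.

    For paths of one vertex ([exists_parent_same_label]) each new vertex is
    labelled at once.  As there are finitely many labels, the adversary can
    reach a position from which every label still attainable stays attainable
    forever, as long as it builds to the right of what is there.  It then
    produces, side by side, one root of each attainable label, and puts a
    common parent above all of them.  The label of this parent is attainable,
    so it is the label of one of its children. *)

(** * Separating finite sets of reals *)

Lemma gt_all_lt (R : realFieldType) (a : R) (B : seq R) :
  {in B, forall b, a < b} -> exists2 x, a < x & {in B, forall b, x < b}.
Proof.
elim: B => [|b B IH] aB; first by exists (a + 1) => //; lra.
have [c cB|x ax xB] := IH; first by apply: aB; rewrite inE cB orbT.
have ab : a < b by apply: aB; rewrite mem_head.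
have [xb|bx] := ltP x b.
  by exists x => // c; rewrite inE => /predU1P[->|/xB].
exists ((a + b) / 2) => [|c]; first lra.
by rewrite inE => /predU1P[->|/xB]; lra.
Qed.

(** With one of the two lists empty this gives a bound for the other one. *)
Lemma exists_between (R : realFieldType) (A B : seq R) :
  {in A & B, forall a b, a < b} ->
  exists2 x, {in A, forall a, a < x} & {in B, forall b, x < b}.
Proof.
elim: A => [|a A IH] AB.
  elim: B {AB} => [|b B [x _ xB]]; first by exists 0.
  exists (Num.min x b - 1) => // c; rewrite inE => /predU1P[->|/xB xc].
    by have := ge_min b x b; rewrite lexx orbT => bx; lra.
  by have := ge_min x x b; rewrite lexx => bx; lra.
have [c d cA dB|x Ax xB] := IH; first by apply: AB; rewrite ?inE ?cA ?orbT.
have [ax|xa] := ltP a x.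
  by exists x => // c; rewrite inE => /predU1P[->|/Ax].
have [b bB|y ay yB] := @gt_all_lt _ a B.
  by apply: AB; rewrite ?mem_head.
exists y => // c; rewrite inE => /predU1P[->//|/Ax]; lra.
Qed.

(** * Tower families as growing forests *)

Section Game.
Variable R : realType.
Implicit Types (a b l u v w : brect R) (s t Q : seq (brect R)).

Definition spans b (x : R) : bool := left_end b <= x <= right_end b.

Lemma left_lt_right b : left_end b < right_end b.
Proof. exact: (valP b). Qed.

Lemma spans_left b : spans b (left_end b).
Proof. by rewrite /spans lexx ltW ?left_lt_right. Qed.

Lemma intersecting_spans a b x : spans a x -> spans b x -> intersecting a b.
Proof.
move=> ax bx; exists (x, Num.min (height a) (height b)).
by rewrite /covers /= -/(spans a x) -/(spans b x) ax bx !ge_min !lexx orbT.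
Qed.

Lemma right_lt_left_disjoint a b :
  right_end a < left_end b -> forall x, spans a x -> ~~ spans b x.
Proof.
move=> ab x /andP[_ xa]; apply/negP => /andP[bx _].
by have := lt_le_trans ab (le_trans bx xa); rewrite ltxx.
Qed.

Lemma intersecting_sym a b : intersecting a b -> intersecting b a.
Proof. by case=> p; rewrite andbC; exists p. Qed.

Lemma right_lt_left_nintersecting a b :
  right_end a < left_end b -> ~ intersecting a b.
Proof.
by move=> /right_lt_left_disjoint ab [p /andP[/andP[/ab/negP apb _] /andP[]]].
Qed.

Definition position s : Prop := from_above s /\ tower_family s.

Lemma from_above_rcons s v :
  from_above (rcons s v) -> {in s, forall b, height v < height b}.
Proof.
rewrite /from_above sorted_pairwise; last by move=> a b c /[swap]; apply: lt_trans.
by rewrite pairwise_rcons => /andP[/allP sv _] b /sv.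
Qed.

Lemma position_prefix s t : position (s ++ t) -> position s.
Proof.
move=> [/sortedP fs ts]; split; last first.
  by move=> a b sa sb; apply: ts; rewrite mem_cat ?sa ?sb.
case: s fs ts => // a s fs ts; apply/(sortedP a) => i lti.
have := fs a i; rewrite size_cat !nth_cat lti (ltnW lti); apply.
exact: leq_trans lti (leq_addr _ _).
Qed.

Lemma position_rcons s v :
  position s -> {in s, forall b, height v < height b} ->
  {in s, forall b, intersecting v b -> below_in_tower v b} ->
  position (rcons s v).
Proof.
move=> [fs ts] hv tv; split.
  case: s fs hv {ts tv} => //= a s fs hv.
  by rewrite /from_above /= rcons_path fs hv // mem_last.
move=> a b; rewrite !mem_rcons !inE.
move=> /predU1P[->|sa] /predU1P[->|sb]; first by rewrite eqxx.
- by move=> _ /tv vb; rewrite /tower vb.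
- by move=> _ /intersecting_sym/tv va; rewrite /tower va ?orbT.
- exact: ts.
Qed.

(** In a tower the wider rectangle is the lower, hence the later one, so an
    older rectangle can only lie strictly inside the new one: the left end of
    a vertex singles out the path that starts at this vertex. *)
Lemma new_left_end_uncovered s v :
  position (rcons s v) -> [seq b <- s | spans b (left_end v)] = [::].
Proof.
move=> [fs ts]; have hv := from_above_rcons fs.
apply/eqP; rewrite -[_ == _]negbK -has_filter; apply/hasPn => b sb; apply/negP => bv.
have vb := hv b sb.
have /ts : b \in rcons s v by rewrite mem_rcons inE sb orbT.
move=> /(_ v); rewrite mem_rcons mem_head => /(_ isT).
have -> : b != v by apply: contraTneq vb => ->; rewrite ltxx.
move=> /(_ isT (intersecting_spans bv (spans_left v))).
move: bv vb; rewrite /tower /below_in_tower /spans.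
by move=> /andP[bv _] vb /orP[] /and3P[]; lra.
Qed.

(** The passage from [s] to [s'], where [v] becomes the parent of the root [l];
    the rectangles of [t] may grow anything elsewhere, but leave [l] a root. *)
Definition parent_step s l s' v : Prop := exists t,
  [/\ s' = rcons (s ++ t) v, position s',
      {in t, forall b x, spans l x -> ~~ spans b x} &
      forall x, spans l x -> spans v x].

(** Paths are listed with the newest vertex, the root, in front: prolonging a
    path is then [cons], and forgetting its lowest vertex is [belast]. *)
Definition tree_path s P : Prop := exists x, [seq b <- s | spans b x] = rev P.

Lemma tree_path_step s l Q s' v :
  tree_path s (l :: Q) -> parent_step s l s' v -> tree_path s' (v :: l :: Q).
Proof.
move=> [x sx] [t [-> _ tl lv]]; exists x.
have lx : spans l x.
  have : l \in [seq b <- s | spans b x] by rewrite sx mem_rev mem_head.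
  by rewrite mem_filter => /andP[].
rewrite filter_rcons lv // filter_cat sx [rev (v :: _)]rev_cons.
suff -> : [seq b <- t | spans b x] = [::] by rewrite cats0.
by apply/eqP; rewrite -[_ == _]negbK -has_filter; apply/hasPn => b /tl; apply.
Qed.

(** Continuing only to the right of [s] leaves all roots of [s] available, and
    lets a later interval contain everything in [t] without meeting [s]. *)
Definition beside s t : Prop :=
  position (s ++ t) /\ {in s & t, forall a b, right_end a < left_end b}.

Lemma beside_cat s t t' : beside s t -> beside (s ++ t) t' -> beside s (t ++ t').
Proof.
move=> [_ st] [p stt']; split; first by rewrite catA.
move=> a b sa; rewrite mem_cat => /orP[/st|tb]; first exact.
by apply: stt'; rewrite // mem_cat sa.
Qed.

Lemma exists_parent s t : beside s t ->
  exists2 v, beside s (rcons t v) & {in t, forall b x, spans b x -> spans v x}.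
Proof.
move=> [pst st].
have [_ _ /mapP[a sa ->] /mapP[b tb ->]|y sy yt] :=
  @exists_between _ (map (@right_end R) s) (map (@left_end R) t).
  exact: st.
have [//|z zt _] := @exists_between _ (y :: map (@right_end R) t) [::].
have [//|h _ hst] := @exists_between _ [::] (map (@height R) (s ++ t)).
have yz : y < z by apply: zt; rewrite mem_head.
pose v : brect R := @BRect R (y, z, h) yz.
have vt b : b \in t -> left_end v < left_end b /\ right_end b < right_end v.
  move=> tb; split; first by apply: yt; apply: map_f.
  by apply: zt; rewrite inE map_f ?orbT.
have hv : {in s ++ t, forall b, height v < height b}.
  by move=> b stb; apply: hst; apply: map_f.
have sv : {in s, forall b, right_end b < left_end v}.
  by move=> b sb; apply: sy; apply: map_f.
exists v; last first.
  move=> b /vt[lv rv] x /andP[lx rx].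
  by rewrite /spans (ltW (lt_le_trans lv lx)) (ltW (le_lt_trans rx rv)).
split; last first.
  move=> a b sa; rewrite mem_rcons inE => /predU1P[->|]; first exact: sv.
  exact: st.
rewrite -rcons_cat; apply: position_rcons => // b stb vb.
move: (stb); rewrite mem_cat => /orP[/sv|/vt[lv rv]].
  by move=> /right_lt_left_nintersecting[]; apply: intersecting_sym.
by rewrite /below_in_tower lv rv hv.
Qed.

(** * Labels of single roots *)

Section Labels.
Variables (X : finType) (h : seq (brect R) -> brect R -> X).

Definition attainable (T : X) s : Prop :=
  exists t u, beside s (rcons t u) /\ h (s ++ rcons t u) u = T.

Lemma attainable_beside T s t :
  beside s t -> attainable T (s ++ t) -> attainable T s.
Proof.
move=> st [t' [u [stt' hT]]]; exists (t ++ t'), u.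
by rewrite rcons_cat catA; split=> //; apply: beside_cat.
Qed.

(** The negation says that a well-chosen continuation makes an attainable label
    unattainable for good; settled labels are attainable forever or never. *)
Definition settled T s : Prop :=
  attainable T s -> forall t, beside s t -> attainable T (s ++ t).

Lemma settled_beside T s t : beside s t -> settled T s -> settled T (s ++ t).
Proof.
move=> st sT sta t' stt'; rewrite -catA.
exact: sT (attainable_beside st sta) _ (beside_cat st stt').
Qed.

(** Whenever a label is not settled, continue so as to lose it forever; this
    settles it, and settled labels stay settled. *)
Lemma exists_settled s (L : seq X) : position s ->
  exists2 t, beside s t & {in L, forall T, settled T (s ++ t)}.
Proof.
move=> ps; elim: L => [|T L [t st tL]].
  by exists [::] => //; split; rewrite ?cats0.
have [sT|nsT] := pselect (settled T (s ++ t)).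
  by exists t => // T'; rewrite inE => /predU1P[->|/tL].
have [t' stt' nT] : exists2 t', beside (s ++ t) t' & ~ attainable T (s ++ t ++ t').
  apply: contra_notP nsT => nt' _ t' stt'.
  by apply: contra_notP nt' => na; exists t' => //; rewrite catA.
exists (t ++ t'); first exact: beside_cat.
move=> T'; rewrite inE => /predU1P[->//|/tL sT'].
by rewrite catA; apply: settled_beside.
Qed.

(** The labels are produced in turn.  The last condition keeps [u] a root until
    the end of [t], so that a parent can be put above all these vertices. *)
Lemma exists_all_labels s (L : seq X) : position s ->
  {in L, forall T t, beside s t -> attainable T (s ++ t)} ->
  exists2 t, beside s t & {in L, forall T, exists t1 u t2,
    [/\ t = rcons t1 u ++ t2, h (s ++ rcons t1 u) u = T &
        {in t2, forall b, right_end u < left_end b}]}.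
Proof.
move=> ps; elim: L => [|T L IH] sL.
  by exists [::] => //; split; rewrite ?cats0.
have [T' LT'|t st tL] := IH; first by apply: sL; rewrite inE LT' orbT.
have [|t' [u [stt' hT]]] := sL T _ t st; first by rewrite mem_head.
exists (t ++ rcons t' u); first exact: beside_cat.
move=> T'; rewrite inE => /predU1P[->|/tL[t1 [w [t2 [tE hT' wt2]]]]].
  by exists (t ++ t'), u, [::]; rewrite cats0 rcons_cat catA.
exists t1, w, (t2 ++ rcons t' u); split=> //; first by rewrite tE catA.
move=> b; rewrite mem_cat => /orP[/wt2//|tb].
apply: stt'.2 => //.
by rewrite tE !mem_cat mem_rcons mem_head orbT.
Qed.

(** The case of paths with one vertex.  The common parent [v] of roots with all
    attainable labels has itself an attainable label, since it was placed
    beside [s], so one of its children has the same label. *)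
Lemma exists_parent_same_label : exists s u s' v,
  [/\ tree_path s [:: u], parent_step s u s' v & h s u = h s' v].
Proof.
have [|s [ps _] /= sX] := @exists_settled [::] (enum X); first by split=> // a.
have [||t st tX] := @exists_all_labels s [seq T <- enum X | `[< attainable T s >]].
- exact: ps.
- by move=> T; rewrite mem_filter => /andP[/asboolP sT /sX]; apply.
have [v sv tv] := exists_parent st.
(* The label of [v] is attainable from [s]: witnessed by [v] itself. *)
have [|t1 [u [t2 [tE hu ut2]]]] := tX (h (s ++ rcons t v) v).
  rewrite mem_filter mem_enum andbT; apply/asboolP.
  by exists t, v.
have pv := sv.1; have pt := st.1.
exists (s ++ rcons t1 u), u, (s ++ rcons t v), v; split=> //; last first.
  exists t2; split=> //.
  - by rewrite -catA -tE rcons_cat.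
  - by move=> b /ut2/right_lt_left_disjoint.
  - by apply: tv; rewrite tE mem_cat mem_rcons mem_head.
have pu : position (rcons (s ++ t1) u).
  by apply: (@position_prefix _ (t2)); rewrite rcons_cat -catA -tE.
exists (left_end u).
by rewrite -rcons_cat filter_rcons spans_left new_left_end_uncovered.
Qed.
End Labels.

(** * Labels of longer paths *)

(** The induction hypothesis is applied to the labelling [g] of shorter paths
    by the set of values [f] takes after one more step.  The order of events
    matters: the value [f s' v (l :: Q)] of the path is realized first, and
    only then is a parent [w] chosen that makes the shifted path copy it. *)
Lemma exists_path_step_same_label n (X : finType)
    (f : seq (brect R) -> brect R -> seq (brect R) -> X) :
  exists s l Q s' v,
    [/\ size Q = n, tree_path s (l :: Q), parent_step s l s' v &
        f s l Q = f s' v (belast l Q)].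
Proof.
elim: n => [|n IH] in X f *.
  have [s [u [s' [v [su uv fE]]]]] := exists_parent_same_label (fun s u => f s u [::]).
  by exists s, u, [::], s', v.
pose g s l Q := [set x | `[< exists s' v, parent_step s l s' v /\ f s' v (l :: Q) = x >]].
have [s [l [Q [s' [v [sQ slQ lv gE]]]]]] := IH _ g.
have : f s' v (l :: Q) \in g s l Q by rewrite inE; apply/asboolP; exists s', v.
rewrite gE inE => /asboolP[s'' [w [vw fE]]].
exists s', v, (l :: Q), s'', w; split=> //=; first by rewrite sQ.
exact: tree_path_step slQ lv.
Qed.

(** * The colouring game *)

Lemma semi_online_extend k (A : colouring_rule R k) s t b c :
  semi_online_from_above A -> from_above (s ++ t) -> b \in s ->
  A s b = Some c -> A (s ++ t) b = Some c.
Proof.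
move=> hA; elim/last_ind: t => [|t v IH]; first by rewrite cats0.
rewrite -rcons_cat => fv sb sc; apply: hA => //; first by rewrite mem_cat sb.
apply: IH => //; move: fv; rewrite /from_above.
by case: (s ++ t) => //= a r; rewrite rcons_path => /andP[].
Qed.

End Game.

Theorem corollary3p4 (R : realType) (k m : nat) (hk : (0 < k)%N) (hm : (0 < m)%N)
    (A : colouring_rule R k) (hA : semi_online_from_above A) :
  exists s : seq (brect R),
    [/\ from_above s, tower_family s &
        exists (n : nat) (p : R * R),
          [/\ (n <= size s)%N,
              (m <= multiplicity (take n s) p)%N &
              (#|colours_at A (take n s) p| <= 1)%N]].
Proof.
pose f s (l : brect R) Q := [ffun i : 'I_m => nth None (map (A s) (l :: Q)) i].
have [s [l [Q [s' [v [sQ [x sx] [t [s'E ps' _ _]] fE]]]]]] :=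
  exists_path_step_same_label m.-1 f.
have sQm : size (l :: Q) = m by rewrite /= sQ prednK.
have ps : position s.
  by apply: (@position_prefix _ _ (rcons t v)); rewrite -rcons_cat -s'E.
have memQ b : (b \in l :: Q) = (b \in s) && spans b x.
  by rewrite -mem_rev -sx mem_filter andbC.
(* Vertex [i] of the path, counted from the root, keeps its colour and becomes
   vertex [i.+1] of the shifted path; equality of the patterns carries this
   colour back to vertex [i.+1] of the original path. *)
have older i c : (i.+1 < m)%N -> A s (nth l (l :: Q) i) = Some c ->
    A s (nth l (l :: Q) i.+1) = Some c.
  move=> im sc; have := congr1 (fun g : {ffun _ -> _} => g (Ordinal im)) fE.
  have im' := ltnW im.
  have iQ : (i < size Q)%N by rewrite sQ -ltnS prednK.
  rewrite !ffunE [RHS]/= (nth_map l) ?sQm // (nth_map l) ?size_belast //.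
  have -> : nth l (belast l Q) i = nth l (l :: Q) i.
    by rewrite lastI nth_rcons size_belast iQ.
  move=> ->; rewrite s'E rcons_cat; apply: semi_online_extend => //.
    by rewrite -rcons_cat -s'E; case: ps'.
  have : nth l (l :: Q) i \in l :: Q by rewrite mem_nth ?sQm.
  by rewrite memQ => /andP[].
have older_le i j c : (i <= j < m)%N -> A s (nth l (l :: Q) i) = Some c ->
    A s (nth l (l :: Q) j) = Some c.
  move=> /andP[/subnK <-]; elim: (j - i)%N => // d IH dm sc.
  by rewrite addSn; apply: older => //; apply: IH => //; apply: ltnW.
have [//|y _ ys] := @exists_between R [::] (map (@height R) s).
have coversE : {in s, forall b, covers b (x, y) = spans b x}.
  by move=> b sb; rewrite /covers /= [X in _ && X]ltW ?andbT // ys ?map_f.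
exists s; split; [by case: ps | by case: ps |].
exists (size s), (x, y); rewrite take_size; split=> //.
  by rewrite /multiplicity (eq_in_count coversE) -size_filter sx size_rev sQm.
have coloured c : c \in colours_at A s (x, y) ->
    exists2 i, (i < m)%N & A s (nth l (l :: Q) i) = Some c.
  rewrite inE => /hasP[b sb]; rewrite coversE // => /andP[bx /eqP bc].
  have bQ : b \in l :: Q by rewrite memQ sb.
  by exists (index b (l :: Q)); rewrite ?nth_index // -sQm index_mem.
apply/card_le1_eqP => c d /coloured[i im ic] /coloured[j jm jd].
have [ij|/ltnW ji] := leqP i j.
  by have := older_le i j c; rewrite ij jm ic jd => /(_ isT erefl) [].
by have := older_le j i d; rewrite ji im ic jd => /(_ isT erefl) [].
Qed.
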